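(* Let $(X,R^{z_{ij}})$ be a left non-degenerate solution of the parametric set-theoretic Yang-Baxter equation with parameter set $Y\subseteq X$, $R^{z_{ij}}(b,a)=(\sigma_a^{z_{ij}}(b),\tau_b^{z_{ij}}(a))$ for all $a,b\in X$, $z_i,z_j\in Y$, and let $(X,S^{z_{ij}})$ be a solution such that, for all $a,b\in X$ and $z_i,z_j\in Y$, $S^{z_{ij}}(b,a)=(b,\,b\triangleright_{z_{ij}}a)$ and $\tau_b^{z_{ij}}(a)=\big(\sigma^{z_{ji}}_{\sigma_a^{z_{ij}}(b)}\big)^{-1}\big(\sigma_a^{z_{ij}}(b)\triangleright_{z_{ij}}a\big)$. For all $z_i\in Y$ let $K^{z_i}:X\to X$, $x\mapsto\kappa^{z_i}(x)$, with $\kappa^{z_i}$ bijective, be a solution of the reflection equation for $S$, i.e. for all $z_i,z_j\in Y$ $$S_{12}^{z_{ij}}K_1^{z_i}S_{21}^{z_{j\bar i}}K_2^{z_j}=K_2^{z_j}S_{12}^{z_{i\bar j}}K_1^{z_i}S_{21}^{z_{\bar j\bar i}}.$$ Then $K^{z_i}$ also satisfies $$R_{12}^{z_{ij}}K_1^{z_i}R_{21}^{z_{j\bar i}}K_2^{z_j}=K_2^{z_j}R_{12}^{z_{i\bar j}}K_1^{z_i}R_{21}^{z_{\bar j\bar i}}$$ if, for all $a,b\in X$ and $z_i,z_j\in Y$, $$\kappa^{z_j}\big(\sigma_a^{z_{\bar ji}}(b)\big)=\sigma_a^{z_{ji}}\big(\kappa^{z_j}(b)\big).$$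
   Context: $X$ and $Y\subseteq X$ are non-empty sets; $z_{ij}$ denotes dependence on the ordered pair $(z_i,z_j)\in Y\times Y$. $\mu:Y\to Y$ is a fixed involutive map and $z_{\bar i}:=\mu(z_i)$; e.g. $z_{\bar ji}$ means dependence on $(\mu(z_j),z_i)$. $(X,R^{z_{ij}})$ with $R^{z_{ij}}(b,a)=(\sigma_a^{z_{ij}}(b),\tau_b^{z_{ij}}(a))$ is a solution (of the parametric set-theoretic Yang-Baxter equation) if $R_{12}^{z_{12}}R_{13}^{z_{13}}R_{23}^{z_{23}}=R_{23}^{z_{23}}R_{13}^{z_{13}}R_{12}^{z_{12}}$ on $X^3$ for all $z_1,z_2,z_3\in Y$, where $R_{mn}$ acts as $R$ on the $m$-th and $n$-th components; it is left non-degenerate if all $\sigma_a^{z_{ij}}$ are bijections. On $X\times X$: $R_{12}^{z_{ij}}=R^{z_{ij}}$, $R_{21}^{z_{ij}}=\pi R^{z_{ij}}\pi$ with $\pi(x,y)=(y,x)$ (similarly for $S$), $K_1^z(a,b)=(\kappa^z(a),b)$, $K_2^z(a,b)=(a,\kappa^z(b))$; products denote composition. *)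

(* Defs.v *)
From mathcomp Require Import all_boot.
From mathcomp Require Import boolp classical_sets functions.

Set Implicit Arguments.
Unset Strict Implicit.
Unset Printing Implicit Defensive.

Local Open Scope classical_set_scope.
Local Open Scope fun_scope.

Definition bij_inv (A B : Type) (f : A -> B) (bf : bijective f) : B -> A :=
  (bijection_of_bijective bf)^-1.

Lemma bij_invK (A B : Type) (f : A -> B) (bf : bijective f) :
  cancel f (bij_inv bf).
Proof.
by move=> x; apply: (funK (s := bijection_of_bijective bf)); rewrite in_setT.
Qed.

Lemma bij_invKV (A B : Type) (f : A -> B) (bf : bijective f) :
  cancel (bij_inv bf) f.
Proof.
by move=> y; apply: (invK (f := bijection_of_bijective bf)); rewrite in_setT.
Qed.

Section ParametricMaps.
Variable X : Type.
Implicit Types (f : X * X -> X * X) (k : X -> X).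

Definition map12 f (t : X * X * X) : X * X * X :=
  let: (x, y, z) := t in let: (x', y') := f (x, y) in (x', y', z).
Definition map13 f (t : X * X * X) : X * X * X :=
  let: (x, y, z) := t in let: (x', z') := f (x, z) in (x', y, z').
Definition map23 f (t : X * X * X) : X * X * X :=
  let: (x, y, z) := t in let: (y', z') := f (y, z) in (x, y', z').

Definition map21 f : X * X -> X * X := @swap_pair X X \o f \o @swap_pair X X.

Definition act1 k (p : X * X) : X * X := (k p.1, p.2).
Definition act2 k (p : X * X) : X * X := (p.1, k p.2).

(* [Y] coerces to the type of its elements, and [R z1 z2] is R^{z_{12}}. *)
Variable Y : set X.

Definition parametric_YBE (R : Y -> Y -> X * X -> X * X) : Prop :=
  forall z1 z2 z3 : Y,
    map12 (R z1 z2) \o map13 (R z1 z3) \o map23 (R z2 z3)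
      =1 map23 (R z2 z3) \o map13 (R z1 z3) \o map12 (R z1 z2).

(* [sigma zi zj a] is sigma_a^{z_{ij}}. *)
Definition left_nondegenerate (sigma : Y -> Y -> X -> X -> X) : Prop :=
  forall (zi zj : Y) (a : X), bijective (sigma zi zj a).

Definition parametric_reflection (mu : Y -> Y) (R : Y -> Y -> X * X -> X * X)
    (kappa : Y -> X -> X) : Prop :=
  forall zi zj : Y,
    R zi zj \o act1 (kappa zi) \o map21 (R zj (mu zi)) \o act2 (kappa zj)
      =1 act2 (kappa zj) \o R zi (mu zj) \o act1 (kappa zi)
           \o map21 (R (mu zj) (mu zi)).

End ParametricMaps.

(* Main.v *)
(* Evaluated at (x, y), the first component of the reflection equation for S is
     ki (kj y |>_{j ibar} x) = ki (y |>_{jbar ibar} x),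
   and the second is, with u this common value,
     u |>_{ij} kj y = kj (u |>_{i jbar} y).
   The formula for tau says that R(b, a) = (c, t) with c = sigma_a b and
   sigma_c t = c |> a, and the hypothesis on kappa lets kappa pass through each
   sigma at the cost of replacing the parameter by its conjugate. Hence the
   reflection equation for R at (x, y) reduces to the one for S at
   (x, sigma_x^{jbar ibar} y). *)
Require Import Defs.
From mathcomp Require Import all_boot.
From mathcomp Require Import boolp classical_sets functions.

Local Open Scope classical_set_scope.

Theorem proposition3p9 (X : Type) (Y : set X)
    (X_neq0 : [set: X] !=set0) (Y_neq0 : Y !=set0)
    (mu : Y -> Y) (mu_invol : involutive mu)
    (R S : Y -> Y -> X * X -> X * X)
    (sigma tau tri : Y -> Y -> X -> X -> X)
    (R_def : forall (zi zj : Y) (a b : X),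
       R zi zj (b, a) = (sigma zi zj a b, tau zi zj b a))
    (R_sol : parametric_YBE R)
    (R_lnd : left_nondegenerate sigma)
    (S_def : forall (zi zj : Y) (a b : X),
       S zi zj (b, a) = (b, tri zi zj b a))
    (S_sol : parametric_YBE S)
    (tau_def : forall (zi zj : Y) (a b : X),
       tau zi zj b a =
         bij_inv (R_lnd zj zi (sigma zi zj a b))
           (tri zi zj (sigma zi zj a b) a))
    (kappa : Y -> X -> X)
    (kappa_bij : forall zi : Y, bijective (kappa zi))
    (kappa_S : parametric_reflection mu S kappa)
    (kappa_sigma : forall (zi zj : Y) (a b : X),
       kappa zj (sigma (mu zj) zi a b) = sigma zj zi a (kappa zj b)) :
  parametric_reflection mu R kappa.
Proof.
move=> zi zj [x y].
pose y' := sigma (mu zj) (mu zi) x y.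
(* Moving [kappa i] outside turns parameter [i] into [mu i], exactly the one carried by the inverse
   that [tau_def] produces, so the two cancel. *)
have kappaV (i j : Y) (a c : X) :
    sigma i j a (kappa i (bij_inv (R_lnd (mu i) j a) c)) = kappa i c.
  by rewrite -kappa_sigma bij_invKV.
have sigma_kappa : sigma zj (mu zi) x (kappa zj y) = kappa zj y'.
  by rewrite -kappa_sigma.
move: (kappa_S zi zj (x, y')).
rewrite /= /map21 /act1 /act2 /swap_pair /= !S_def /=.
move=> [S_fst S_snd]; rewrite !R_def /=.
(* [kappaV] removes the inner inverses, with [j] being [zj] on the left and [mu zj] on the right. *)
rewrite !tau_def sigma_kappa -/y' !kappaV S_fst.
(* Both second components still hold an outer inverse; applying this [sigma] cancels the left one
   directly and the right one, under [kappa zj], by [kappaV]. *)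
congr (_, _); apply: (bij_inj (R_lnd zj zi (kappa zi (tri (mu zj) (mu zi) y' x)))).
by rewrite bij_invKV kappaV -S_snd S_fst.
Qed.
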